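(* Let $n$ and $k$ be integers with $0\le k<n$. Suppose $X_1,\ldots,X_{n-k}$ are compact subsets of $\mathbb R^n$ and $p\in\mathbb R^n$ is a point that does not belong to $\operatorname{conv}_{k+1} X_i$ for any $i\in\{1,\ldots,n-k\}$. Then there exists an affine $k$-dimensional plane $L\subset\mathbb R^n$ with $p\in L$ such that $L\cap X_i=\emptyset$ for every $i=1,\ldots,n-k$.
   Context: For a compact set $X\subset\mathbb R^n$ and an integer $m\ge 1$, $\operatorname{conv}_{m} X$ denotes the set of points of $\mathbb R^n$ that can be expressed as a convex combination of at most $m$ points of $X$. *)

(* Defs.v *)
From HB Require Import structures.
From mathcomp Require Import all_boot all_order all_algebra.
From mathcomp Require Import all_classical all_reals all_analysis.
Set Implicit Arguments. Unset Strict Implicit. Unset Printing Implicit Defensive.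
Import Order.TTheory GRing.Theory Num.Theory.
Import numFieldNormedType.Exports.
Local Open Scope classical_set_scope.
Local Open Scope ring_scope.

(* conv_m X: points that are convex combinations of at most m points of X.
   Using exactly m (possibly repeated) points with nonnegative weights
   summing to 1 is equivalent to "at most m" (for m >= 1). *)
Definition convm (R : realType) (n m : nat) (X : set 'rV[R]_n) : set 'rV[R]_n :=
  [set x | exists (w : 'I_m -> R) (y : 'I_m -> 'rV[R]_n),
     (forall i, X (y i)) /\ (forall i, 0 <= w i) /\
     \sum_(i < m) w i = 1 /\ x = \sum_(i < m) w i *: y i].

Definition affine_plane (R : realType) (n k : nat) (L : set 'rV[R]_n) : Prop :=
  exists (a : 'rV[R]_n) (V : {vspace 'rV[R]_n}),
    \dim V = k /\ L = [set x | (x - a) \in V].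

(* Main.v *)
Require Import Defs.
From HB Require Import structures.
From mathcomp Require Import all_boot all_order all_algebra.
From mathcomp Require Import all_classical all_reals all_analysis.
From mathcomp Require Import zify lra.
Set Implicit Arguments. Unset Strict Implicit. Unset Printing Implicit Defensive.
Import Order.TTheory GRing.Theory Num.Theory.
Import numFieldNormedType.Exports.
Local Open Scope ring_scope.

(* Let [Y_i] be a fine finite net of [X_i].  For a frame [u] of [k] vectors
   spanning [V], weight the points of [Y_i - p] near [V] and add up their
   projections to [V]; this gives [n - k] continuous sections of the tautological
   bundle.  At a common zero of the sections with [u] orthogonal, [p + V] misses
   every [X_i]: otherwise 0 is a convex combination of projections to [V] of
   points of [Y_i - p] close to [V], hence by Caratheodory's theorem in [V] of
   [k + 1] of them, and so [p] is close to [conv_{k+1} X_i].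

   A common zero exists since the top Stiefel-Whitney class of the tautological
   bundle has nonzero [(n - k)]-th power.  In concrete terms, let [u] range over
   the product of spheres of dimensions [n - 1, n - 2, .., n - k] with the group
   [(Z/2)^k] flipping the rows.  The equations "rows [a < b] are orthogonal" have
   character [t_a + t_b], those of the sections have characters [t_j], and the
   coefficient of [\prod_j t_j^(n-1-j)] in the product of all characters is odd.
   This coefficient is the value on a fundamental chain of the cup product of the
   coboundaries of the signs of the equations; the chain may be subdivided
   barycentrically, so some arbitrarily small simplex sees both signs of every
   equation, and compactness yields the zero. *)

(** * Chains modulo 2 *)

Lemma addF2 (x : 'F_2) : x + x = 0.
Proof. exact: (addrr_pchar2 (pchar_Fp (isT : prime 2))). Qed.

Lemma oppF2 (x : 'F_2) : - x = x.
Proof. exact: (oppr_pchar2 (pchar_Fp (isT : prime 2))). Qed.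

(** The terms at [(i, j)] and [(j, i)] cancel modulo 2; this makes the double boundary of a product
    cell vanish. *)
Lemma sum_sym_F2 (I : finType) (F : I -> I -> 'F_2) :
  (forall i j, F i j = F j i) -> (forall i, F i i = 0) ->
  \sum_i \sum_j F i j = 0.
Proof.
move=> Fsym F0.
have -> : \sum_i \sum_j F i j =
    \sum_i \sum_j ((if (enum_rank i < enum_rank j)%N then F i j else 0) +
                   (if (enum_rank j < enum_rank i)%N then F i j else 0)).
  apply: eq_bigr => i _; apply: eq_bigr => j _.
  case: ltngtP => [_|_|/ord_inj/enum_rank_inj ->]; rewrite ?addr0 ?add0r //.
under eq_bigr do rewrite big_split /=.
rewrite big_split /= [X in _ + X]exchange_big /=.
rewrite [X in _ + X](_ : _ = \sum_i \sum_j
  (if (enum_rank i < enum_rank j)%N then F i j else 0)) ?addF2 //.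
by apply: eq_bigr => i _; apply: eq_bigr => j _; rewrite Fsym.
Qed.

Section Chains.
Variable T : eqType.
Implicit Types (phi : seq T -> 'F_2) (t : seq T) (c : seq (seq T)).

Definition ev phi c : 'F_2 := \sum_(t <- c) phi t.

(* The boundary of a point is the empty simplex: with this augmentation the cone
   identity [ev_bd_cone] holds in all dimensions. *)
Fixpoint bd t : seq (seq T) :=
  if t is v :: t' then t' :: map (cons v) (bd t') else [::].

Lemma bd_cons v t : bd (v :: t) = t :: map (cons v) (bd t).
Proof. by []. Qed.

Definition cone (b : T) c := map (cons b) c.

Lemma ev_nil phi : ev phi [::] = 0.
Proof. by rewrite /ev big_nil. Qed.

Lemma ev_cons phi t c : ev phi (t :: c) = phi t + ev phi c.
Proof. by rewrite /ev big_cons. Qed.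

Lemma ev_cat phi c c' : ev phi (c ++ c') = ev phi c + ev phi c'.
Proof. by rewrite /ev big_cat. Qed.

Lemma ev_flatten (S : Type) phi (f : S -> seq (seq T)) (s : seq S) :
  ev phi (flatten (map f s)) = \sum_(x <- s) ev phi (f x).
Proof. by rewrite /ev big_flatten big_map. Qed.

Lemma ev_map phi (f : seq T -> seq T) c : ev phi (map f c) = ev (phi \o f) c.
Proof. by rewrite /ev big_map. Qed.

Lemma eq_ev phi psi c : phi =1 psi -> ev phi c = ev psi c.
Proof. by move=> e; apply: eq_bigr => t _; rewrite e. Qed.

Lemma eq_in_ev phi psi c : {in c, phi =1 psi} -> ev phi c = ev psi c.
Proof. by move=> e; apply: eq_big_seq. Qed.

Lemma ev_neq0 phi c : ev phi c != 0 -> exists2 t, t \in c & phi t != 0.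
Proof.
have [/hasP//|/hasPn c0] := boolP (has (fun t => phi t != 0) c).
by rewrite /ev big1_seq ?eqxx // => t /andP[_ /c0]; rewrite negbK => /eqP.
Qed.

Lemma evD phi psi c : ev (fun t => phi t + psi t) c = ev phi c + ev psi c.
Proof. exact: big_split. Qed.

Lemma evZ a phi c : ev (fun t => a * phi t) c = a * ev phi c.
Proof. by rewrite /ev mulr_sumr. Qed.

Definition bdc c := flatten (map bd c).

Lemma ev_bdc phi c : ev phi (bdc c) = ev (fun t => ev phi (bd t)) c.
Proof. exact: ev_flatten. Qed.

Lemma ev_bd_cone phi b c :
  ev phi (bdc (cone b c)) = ev phi c + ev (phi \o cons b) (bdc c).
Proof.
rewrite !ev_bdc ev_map -evD; apply: eq_ev => t /=.
by rewrite ev_cons ev_map.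
Qed.

Lemma ev_bd_bd phi t : ev phi (bdc (bd t)) = 0.
Proof.
elim: t phi => [|v t IH] phi /=; first by rewrite /bdc /= ev_nil.
by rewrite ev_bdc ev_cons -ev_bdc ev_bd_cone IH addr0 addF2.
Qed.

Lemma size_bd t t' : t' \in bd t -> size t = (size t').+1.
Proof.
elim: t t' => //= v t IH t'; rewrite inE => /orP[/eqP -> //|/mapP[u /IH -> ->]].
by [].
Qed.

Lemma sub_bd t t' : t' \in bd t -> {subset t' <= t}.
Proof.
elim: t t' => //= v t IH t'; rewrite inE => /orP[/eqP ->|/mapP[u /IH ut ->]] x.
  by rewrite inE orbC => ->.
by rewrite !inE => /orP[->|/ut ->] //; rewrite orbT.
Qed.

Lemma map_bd (f : T -> T) t : bd (map f t) = map (map f) (bd t).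
Proof. by elim: t => //= v t ->; rewrite -!map_comp. Qed.

End Chains.

(** * Cup products of coboundaries modulo 2 *)

Section CupProduct.
Variables (T I : eqType) (s : I -> T -> 'F_2).
Implicit Types (phi : seq T -> 'F_2) (t : seq T) (L : seq I).

(* [Phi [:: i_1; ..; i_N]] is the cup product of the coboundaries of the
   0-cochains [s i_1], .., [s i_N]. *)
Fixpoint Phi (L : seq I) t : 'F_2 :=
  match L, t with
  | [::], [:: _] => 1
  | i :: L', v :: ((w :: _) as t') => (s i v + s i w) * Phi L' t'
  | _, _ => 0
  end.

(** The cup product of the 0-cochain [s i] with [phi]. *)
Definition cap i phi t : 'F_2 :=
  if t is v :: _ then s i v * phi t else 0.

(** Leibniz rule for [s i] and the cocycle [Phi L]. The cocycle property is a hypothesis because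
    [Phi_cocycle] is proved by induction from this lemma. *)
Lemma Phi_cap i L t :
  (forall t', size t' = (size L).+2 -> ev (Phi L) (bd t') = 0) ->
  size t = (size L).+2 -> Phi (i :: L) t = ev (cap i (Phi L)) (bd t).
Proof.
move=> cocyc; case: t => [|v [|w t]] // szt; have := cocyc _ szt.
rewrite bd_cons ev_cons ev_map => /eqP; rewrite addr_eq0 oppF2 => /eqP e.
rewrite ev_cons ev_map.
have -> : ev (cap i (Phi L) \o cons v) (bd (w :: t)) = s i v * Phi L (w :: t).
  by rewrite e -evZ.
by rewrite /= mulrDl addrC.
Qed.

(** A product with at least one factor is a coboundary by [Phi_cap]; for the empty product, an edge
    has two endpoints. *)
Lemma Phi_cocycle L t :
  size t = (size L).+2 -> ev (Phi L) (bd t) = 0.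
Proof.
elim: L t => [|i L IH] t szt.
  by case: t szt => [|v [|w []]] //=; rewrite !ev_cons ev_nil addr0 addF2.
rewrite -(ev_bd_bd (cap i (Phi L)) t) ev_bdc.
apply: eq_in_ev => t' t't; apply: Phi_cap => //.
by apply/eqP; rewrite -eqSS -(size_bd t't) szt.
Qed.

Lemma PhiE i L t :
  size t = (size L).+2 -> Phi (i :: L) t = ev (cap i (Phi L)) (bd t).
Proof. by apply: Phi_cap => t'; exact: Phi_cocycle. Qed.

Lemma Phi_neq0 L t i :
  Phi L t != 0 -> i \in L -> exists u v, [/\ u \in t, v \in t & s i u != s i v].
Proof.
elim: L t => [|j L IH] [|v [|w t]] //=; rewrite ?eqxx // mulf_eq0 negb_or.
case/andP=> nz nzP; rewrite inE => /orP[/eqP -> | /(IH _ nzP)].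
  exists v, w; rewrite !inE !eqxx orbT; split=> //.
  by apply: contraNneq nz => ->; rewrite addF2.
by case=> x [y [xt yt xy]]; exists x, y; rewrite !(in_cons v) xt yt !orbT.
Qed.

(** Only differences of values of [s i] enter [Phi], so the shift by [chi i] cancels. *)
Lemma Phi_map (f : T -> T) (D : pred T) (chi : I -> 'F_2) L t :
  (forall i v, i \in L -> D v -> s i (f v) = s i v + chi i) ->
  all D t -> Phi L (map f t) = Phi L t.
Proof.
elim: L t => [|i L IH] [|v [|w t]] //= equi /and3P[Dv Dw Dt].
rewrite -(IH (w :: t)) /= ?Dw //; last by move=> j x jL; apply: equi; rewrite inE jL orbT.
by rewrite !equi ?inE ?eqxx // addrACA addF2 addr0.
Qed.
End CupProduct.

(** * Barycentric subdivision *)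

Section Subdivision.
Variables (R : fieldType) (V : lmodType R).
Implicit Types (phi : seq V -> 'F_2) (t : seq V) (c : seq (seq V)).

Definition bary t : V := (size t)%:R^-1 *: \sum_(v <- t) v.

(** [n] is fuel, meant to be the number of vertices of [t]; the empty simplex is its own
    subdivision. *)
Fixpoint sdn n t : seq (seq V) :=
  if n is m.+1 then cone (bary t) (flatten (map (sdn m) (bd t))) else [:: t].

Definition sd t := sdn (size t) t.

Definition sdc c := flatten (map sd c).

Lemma ev_sdc phi c : ev phi (sdc c) = ev (fun t => ev phi (sd t)) c.
Proof. exact: ev_flatten. Qed.

Lemma sd_cons v t : sd (v :: t) = cone (bary (v :: t)) (sdc (bd (v :: t))).
Proof.
change (cone (bary (v :: t)) (flatten (map (sdn (size t)) (bd (v :: t)))) =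
        cone (bary (v :: t)) (flatten (map sd (bd (v :: t))))).
by congr (cone _ (flatten _)); apply/eq_in_map => t' /size_bd [->].
Qed.

(** Subdivision is a chain map. In the boundary of the cone from the barycentre, the part containing
    the apex is, by induction, a cone over the subdivided double boundary of [t], which vanishes. *)
Lemma ev_bd_sd phi t : ev phi (bdc (sd t)) = ev phi (sdc (bd t)).
Proof.
have [n] := ubnP (size t); elim: n t phi => // n IH [|v t] phi szt.
  by rewrite /bdc /sdc /= !ev_nil.
rewrite sd_cons ev_bd_cone [X in _ + X](_ : _ = 0) ?addr0 //.
set psi := phi \o _.
rewrite ev_bdc ev_sdc -(ev_bd_bd (fun t => ev psi (sd t)) (v :: t)) ev_bdc.
apply: eq_in_ev => t' t't; have szt' := size_bd t't.
rewrite -ev_bdc IH ?ev_sdc //.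
by rewrite szt' in szt.
Qed.

Lemma ev_bdc_sdc phi c : ev phi (bdc (sdc c)) = ev phi (sdc (bdc c)).
Proof.
rewrite ev_bdc !ev_sdc ev_bdc; apply: eq_bigr => t _.
by rewrite -ev_bdc ev_bd_sd ev_sdc.
Qed.

Lemma bary_map (f : {linear V -> V}) t : bary (map f t) = f (bary t).
Proof. by rewrite /bary size_map big_map linearZ /= [f _]linear_sum. Qed.

Lemma sd_map (f : {linear V -> V}) t : sd (map f t) = map (map f) (sd t).
Proof.
rewrite /sd size_map; move: (size t) => n; elim: n t => //= n IH t.
have e : map (sdn n) (map (map f) (bd t)) = map (map (map f)) (map (sdn n) (bd t)).
  by rewrite -!map_comp; apply: eq_map => u; exact: IH.
rewrite bary_map map_bd e -map_flatten /cone -!map_comp.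
by apply: eq_map.
Qed.

Definition bary_closed (C : V -> Prop) :=
  forall t, t != [::] -> (forall v, v \in t -> C v) -> C (bary t).

Lemma size_sd t t' : t' \in sd t -> size t' = size t.
Proof.
suff sz n u : size u = n -> t' \in sdn n u -> size t' = n by exact: sz.
elim: n u t' => [|n IH] u t' szu /=; first by rewrite inE => /eqP ->.
case/mapP => x /flattenP[c /mapP[u1 u1u ->]] xu1 -> /=.
by rewrite (IH u1) //; have := size_bd u1u; rewrite szu => -[].
Qed.

Lemma sd_closed (C : V -> Prop) t t' : bary_closed C ->
  (forall v, v \in t -> C v) -> t' \in sd t -> forall v, v \in t' -> C v.
Proof.
move=> Cb; rewrite /sd; move: (size t) => n; elim: n t t' => [|n IH] t t' Ct /=.
  by rewrite inE => /eqP ->.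
case/mapP => u /flattenP[c /mapP[t1 t1t ->]] ut1 -> v.
rewrite inE => /orP[/eqP ->|]; last first.
  by apply: IH ut1 _ => x xt1; apply: Ct; apply: sub_bd t1t _ xt1.
by apply: Cb => //; case: (t) t1t.
Qed.

Lemma sdc_mem c t : t \in sdc c -> exists2 u, u \in c & t \in sd u.
Proof. by case/flattenP => x /mapP[u uc ->]; exists u. Qed.

End Subdivision.

(** * Equivariant chains on a product of spheres *)

Section Resolution.
Variables (R : fieldType) (V : lmodType R) (k : nat).
Variable g : 'I_k -> {linear V -> V}.
Implicit Types (phi : seq V -> 'F_2) (m : {ffun 'I_k -> nat}) (i j : 'I_k).
Implicit Type h : nat -> {ffun 'I_k -> nat} -> seq (seq V).

Definition dec j m := [ffun i => (m i - (i == j))%N].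

Lemma sum_dec j m N : (0 < m j)%N -> (\sum_i m i)%N = N.+1 ->
  (\sum_i dec j m i)%N = N.
Proof.
move=> mj; rewrite (bigD1 j) //= (bigD1 (P := xpredT) j) //= ffunE eqxx.
under [in X in _ -> X]eq_bigr => i /negPf ij do rewrite ffunE ij subn0.
by move: mj; case: (m j) => // a _; rewrite subn1 addSn => -[].
Qed.

(* The boundary relation of the cells [e_m] of the tensor product over the rows
   of the standard free resolutions of F_2 over the group of order 2. *)
Definition resolution h := forall N m phi, (\sum_i m i)%N = N.+1 ->
  ev phi (bdc (h N.+1 m)) = \sum_(j | (0 < m j)%N)
    (ev phi (h N (dec j m)) + ev (phi \o map (g j)) (h N (dec j m))).

(** Subdivision commutes with boundaries and with the linear maps [g j]. *)
Lemma resolution_sdc h :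
  resolution h -> resolution (fun N m => sdc (h N m)).
Proof.
move=> hres N m phi sm; rewrite ev_bdc_sdc ev_sdc hres //.
apply: eq_bigr => j _; rewrite !ev_sdc; congr (_ + _).
by apply: eq_ev => t /=; rewrite sd_map ev_map.
Qed.

Variable E : {ffun 'I_k -> nat} -> V.

(* If [E m] is the product of the apices, this is a triangulated product of
   hemispheres of dimensions [m j], as a cone over its boundary. *)
Fixpoint hemi N m : seq (seq V) :=
  if N is N'.+1 then
    cone (E m) (flatten [seq hemi N' (dec j m) ++ map (map (g j)) (hemi N' (dec j m))
                        | j <- enum 'I_k & (0 < m j)%N])
  else [:: [:: E m]].

Hypothesis gK : forall j, involutive (g j).
Hypothesis gC : forall i j v, g i (g j v) = g j (g i v).

Lemma decC i j m : dec i (dec j m) = dec j (dec i m).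
Proof. by apply/ffunP => l; rewrite !ffunE subnAC. Qed.

(** By the cone identity it suffices that the base is a cycle. Its boundary is a sum over pairs of
    [(1 + g j) (1 + g i)] applied to cells; this is symmetric since the maps commute, and zero on
    the diagonal since [(1 + g j)^2 = 0] modulo 2. *)
Lemma hemi_resolution : resolution hemi.
Proof.
have ev_hemi N m phi : ev phi (flatten
    [seq hemi N (dec j m) ++ map (map (g j)) (hemi N (dec j m))
    | j <- enum 'I_k & (0 < m j)%N]) = \sum_(j | (0 < m j)%N)
      (ev phi (hemi N (dec j m)) + ev (phi \o map (g j)) (hemi N (dec j m))).
  rewrite ev_flatten big_filter big_enum_cond /=.
  by apply: eq_big => [j|j _]; rewrite ?ev_cat ?ev_map.
elim=> [|N IH] m phi sm.
  rewrite [hemi _ _]/= ev_bd_cone -[RHS]addr0 (ev_hemi 0%N); congr (_ + _).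
  (* The two points of a 0-sphere both have the empty simplex as boundary. *)
  rewrite ev_bdc (ev_hemi 0%N) big1 // => j mj /=.
  by rewrite !ev_cons !ev_nil /= !ev_cons !ev_nil /= !addr0 addF2.
change (hemi N.+2 m) with (cone (E m) (flatten
    [seq hemi N.+1 (dec j m) ++ map (map (g j)) (hemi N.+1 (dec j m))
    | j <- enum 'I_k & (0 < m j)%N])).
rewrite ev_bd_cone -[RHS]addr0 ev_hemi; congr (_ + _).
set psi := phi \o _; rewrite ev_bdc ev_hemi.
(* [A j i] is [psi] on [(1 + g j) (1 + g i)] applied to one cell, when both decrements are
   possible. *)
pose A j i := if (0 < m j)%N && (0 < dec j m i)%N then
   ev psi (hemi N (dec i (dec j m))) + ev (psi \o map (g i)) (hemi N (dec i (dec j m)))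
   + (ev (psi \o map (g j)) (hemi N (dec i (dec j m)))
   + ev (psi \o map (g j) \o map (g i)) (hemi N (dec i (dec j m)))) else 0.
transitivity (\sum_j \sum_i A j i); last apply: sum_sym_F2.
- rewrite big_mkcond /=; apply: eq_bigr => j _; rewrite /A.
  case: (ltnP 0 (m j)) => mj /=; last by rewrite big1.
  rewrite -big_mkcond /= big_split /=.
  have sm' := sum_dec mj sm.
  rewrite -ev_bdc IH // big_split /=; congr (_ + _).
  by rewrite -IH // ev_bdc; apply: eq_ev => t /=; rewrite map_bd ev_map.
- move=> i j; rewrite /A decC !ffunE.
  have -> : (0 < m i)%N && (0 < m j - (j == i))%N = (0 < m j)%N && (0 < m i - (i == j))%N.
    by case: (eqVneq i j) => [->//|ij]; rewrite !subn0 andbC.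
  case: ifP => // _; rewrite addrACA; congr (_ + (_ + _)).
  apply: eq_ev => t /=; congr (psi _).
  by rewrite -!map_comp; apply: eq_map => v /=.
- move=> i; rewrite /A; case: ifP => // _; set c := hemi _ _.
  rewrite [ev (_ \o map (g i)) c + _]addrC.
  rewrite [X in _ + (X + _)](eq_ev (psi := psi)) ?addF2 // => t /=.
  by rewrite -map_comp map_id_in // => v _ /=; rewrite gK.
Qed.
End Resolution.

(** * Coefficients of a product of characters *)

Section Coefficient.
Variables (k : nat) (I : eqType) (ch : I -> 'I_k * 'I_k).
Implicit Types (m : {ffun 'I_k -> nat}) (L : seq I) (j : 'I_k).

(* The flip of row [j] acts on the test function [i] by the sign [(-1) ^+ chi i j];
   the character is [t_a] if [ch i = (a, a)] and [t_a + t_b] if [ch i = (a, b)]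
   with [a != b]. *)
Definition chi i j := (j == (ch i).1) || (j == (ch i).2).

(* The coefficient of [\prod_j t_j ^+ m j] in the product of these characters. *)
Fixpoint coef L m : 'F_2 :=
  if L is i :: L' then \sum_(j | (0 < m j)%N) (chi i j)%:R * coef L' (dec j m)
  else 1.

Lemma weight_dec j m : (0 < m j)%N ->
  (\sum_(i < k) i * m i)%N = (j + \sum_(i < k) i * dec j m i)%N.
Proof.
move=> mj; rewrite (bigD1 j) //= [in RHS](bigD1 j) //= ffunE eqxx addnA.
congr addn; first by nia.
by apply: eq_bigr => i /negPf ij; rewrite ffunE ij subn0.
Qed.

Hypothesis ch_le : forall i, ((ch i).1 <= (ch i).2)%N.

(* Every monomial of the product picks from each character an index that is at
   least its first component. *)
Lemma coef_eq0 L m :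
  (\sum_(j < k) j * m j < \sum_(i <- L) (ch i).1)%N -> coef L m = 0.
Proof.
elim: L m => [|i L IH] m; first by rewrite big_nil ltn0.
rewrite big_cons => w; rewrite /= big1 // => j mj.
have [/orP jch|] := boolP (chi i j); last by rewrite mul0r.
rewrite IH ?mulr0 //; move: w; rewrite (weight_dec mj).
have jge : ((ch i).1 <= j)%N by case: jch => /eqP ->.
by move=> w; rewrite -(ltn_add2l (ch i).1); apply: leq_ltn_trans w; rewrite leq_add2r.
Qed.

(** The weight [\sum_j j * m j] is the sum of the first components, the least possible. So each
    character must contribute its first component: a larger second one leaves too small a weight for
    the rest, and [coef_eq0] applies. *)
Lemma coef_content L m :
  (forall j, m j = count (fun i => (ch i).1 == j) L) -> coef L m = 1.
Proof.
elim: L m => [//|i L IH] m cont.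
have mi : (0 < m (ch i).1)%N by rewrite cont /= eqxx.
have contL j : dec (ch i).1 m j = count (fun i => (ch i).1 == j) L.
  by rewrite ffunE cont /= [_ == j]eq_sym addKn.
rewrite /= (bigD1 (ch i).1) //= /chi eqxx mul1r IH // big1 ?addr0 // => j /andP[mj jn].
rewrite (negPf jn) /=; case: eqP => [ej|]; last by rewrite mul0r.
rewrite coef_eq0 ?mulr0 //.
have : (\sum_(j < k) j * m j = (ch i).1 + \sum_(i <- L) (ch i).1)%N.
  rewrite (weight_dec mi); congr (_ + _)%N.
  transitivity (\sum_(j < k) j * count (fun i => (ch i).1 == j) L)%N.
    by apply: eq_bigr => l _; rewrite contL.
  elim: (L) => [|l L' IHL]; first by rewrite big_nil big1 // => l _; rewrite muln0.
  rewrite big_cons -IHL /=; under eq_bigr do rewrite mulnDr.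
  rewrite big_split /= (bigD1 (ch l).1) //= eqxx muln1 big1 ?addn0 // => x.
  by rewrite eq_sym => /negPf ->; rewrite muln0.
rewrite (weight_dec mj).
have : ((ch i).1 < j)%N.
  by rewrite ltn_neqAle eq_sym jn /= ej ch_le.
by move: (\sum_(x < k) _)%N (\sum_(x <- L) _)%N => A S; lia.
Qed.
End Coefficient.

(** * Evaluation of the cup product on a resolution *)

Section Evaluation.
Variables (R : fieldType) (V : lmodType R) (k : nat).
Variable g : 'I_k -> {linear V -> V}.
Variables (I : eqType) (ch : I -> 'I_k * 'I_k) (s : I -> V -> 'F_2).
Variable D : pred V.
Variable P : pred {ffun 'I_k -> nat}.
Hypothesis P_dec : forall j m, P m -> P (dec j m).
Hypothesis s_equiv : forall i j v, D v -> s i (g j v) = s i v + (chi ch i j)%:R.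

(** Both sides obey the recursion of [coef]. By [PhiE] the left side is [cap s i (Phi s L)] on the
    boundary, a sum of [1 + g j] applied to smaller cells; as [Phi s L] is invariant and [s i]
    shifts by [chi ch i j], each summand is [chi ch i j] times [Phi s L] on that cell. *)
Lemma Phi_resolution h L (m : {ffun 'I_k -> nat}) : resolution g h ->
  (forall m, ev (Phi s [::]) (h 0%N m) = 1) ->
  (forall N m t, P m -> t \in h N m -> size t = N.+1 /\ all D t) -> P m ->
  (\sum_j m j)%N = size L -> ev (Phi s L) (h (size L) m) = coef ch L m.
Proof.
move=> hres h0 hD; elim: L m => [|i L IH] m Pm sm /=; first exact: h0.
rewrite (eq_in_ev (psi := fun t => ev (cap s i (Phi s L)) (bd t))); last first.
  by move=> t /(hD _ _ _ Pm) [szt _]; exact: PhiE.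
rewrite -ev_bdc hres //; apply: eq_bigr => j mj.
have Pm' := P_dec j Pm; rewrite -IH //; last exact: sum_dec mj sm.
rewrite -evD -evZ; apply: eq_in_ev => t /(hD _ _ _ Pm')[szt Dt].
case: t szt Dt => // v t _ Dt.
have := Phi_map (s := s) (f := g j) (chi := fun i => (chi ch i j)%:R) (L := L) _ Dt.
move=> /= -> //; last by move=> i' x _; exact: s_equiv.
case/andP: Dt => Dv _; rewrite s_equiv // mulrDl addrA.
by rewrite addF2 add0r.
Qed.
End Evaluation.

(** * Diameters under subdivision *)

Section Diameter.
Variables (R : realType) (V : normedModType R).
Implicit Types (t : seq V) (c : seq (seq V)) (d : R).

Definition diam_le t d := forall u v, u \in t -> v \in t -> `|u - v| <= d.

Lemma bary_closed_ball (x : V) d : bary_closed (fun v => `|x - v| <= d).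
Proof.
move=> t t0 td; have sz0 : (0 : R) < (size t)%:R by rewrite ltr0n lt0n size_eq0.
have -> : x - bary t = (size t)%:R^-1 *: \sum_(v <- t) (x - v).
  rewrite sumrB scalerBr big_const_seq count_predT iter_addr_0 -[x *+ _]scaler_nat.
  by rewrite scalerA mulVf ?scale1r // gt_eqF.
rewrite normrZ gtr0_norm ?invr_gt0 // ler_pdivrMl //.
apply: le_trans (ler_norm_sum _ _ _) _.
rewrite big_seq; apply: le_trans (ler_sum _ td) _.
by rewrite -big_seq big_const_seq count_predT iter_addr_0 mulr_natl.
Qed.

(** One of the [n + 1] averaged differences is zero. *)
Lemma bary_dist t d n v : size t = n.+1 -> diam_le t d -> v \in t ->
  `|bary t - v| <= n%:R / n.+1%:R * d.
Proof.
move=> szt td vt.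
have -> : bary t - v = n.+1%:R^-1 *: \sum_(u <- t) (u - v).
  rewrite sumrB scalerBr big_const_seq count_predT iter_addr_0 -[v *+ _]scaler_nat.
  by rewrite szt scalerA mulVf ?scale1r ?pnatr_eq0 // /bary szt.
rewrite normrZ gtr0_norm ?invr_gt0 ?ltr0n // mulrAC mulrC ler_pM2r ?invr_gt0 ?ltr0n //.
apply: le_trans (ler_norm_sum _ _ _) _.
rewrite (big_rem v) //= subrr normr0 add0r.
have -> : n%:R * d = \sum_(u <- rem v t) d.
  by rewrite big_const_seq count_predT size_rem // szt iter_addr_0 mulr_natl.
rewrite big_seq [leRHS]big_seq; apply: ler_sum => u /mem_rem ut; exact: td.
Qed.

(** The factor depends on a bound [N] for the dimension, so that it also serves for the faces in the
    induction. *)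
Lemma diam_sd t t' N d : (size t <= N.+1)%N -> 0 <= d -> diam_le t d ->
  t' \in sd t -> diam_le t' (N%:R / N.+1%:R * d).
Proof.
move=> szN d0 td; suff sub n u : size u = n -> (n <= N.+1)%N -> diam_le u d ->
  t' \in sdn n u -> diam_le t' (N%:R / N.+1%:R * d) by exact: sub szN td.
elim: n u t' {t szN td} => [|n IH] t t' szt szN td /=.
  by rewrite inE => /eqP ->; case: t szt {td} => // _ u v; rewrite in_nil.
case/mapP => x /flattenP[c /mapP[t1 t1t ->]] xt1 ->.
have szt1 : size t1 = n by have := size_bd t1t; rewrite szt => -[].
have subt1 := sub_bd t1t.
have dx : diam_le x (N%:R / N.+1%:R * d).
  apply: IH xt1 => //; first exact: ltnW.
  by move=> u v ut vt; apply: td; apply: subt1.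
(* The ball about [bary t] that contains the vertices of [t1] is convex, so it contains those of the
   subdivision of [t1]. *)
have bx v : v \in x -> `|bary t - v| <= N%:R / N.+1%:R * d.
  move: v; apply: (sd_closed (t := t1)); rewrite /sd ?szt1 //; first exact: bary_closed_ball.
  move=> v /subt1 vt; apply: le_trans (bary_dist szt td vt) _.
  apply: ler_wpM2r => //; rewrite ler_pdivrMr ?ltr0n // mulrAC ler_pdivlMr ?ltr0n //.
  by rewrite -!natrM ler_nat; rewrite !mulnS [(N * n)%N]mulnC leq_add2r.
move=> u v; rewrite !inE => /orP[/eqP ->|ux] /orP[/eqP ->|vx]; last exact: dx.
- by rewrite subrr normr0 mulr_ge0 // divr_ge0.
- exact: bx.
- by rewrite distrC; exact: bx.
Qed.

Lemma iter_sdc_mem r c t : t \in iter r (@sdc R V) c ->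
  exists2 u, u \in c & [/\ size t = size u,
    forall C, bary_closed C -> (forall v, v \in u -> C v) -> forall v, v \in t -> C v &
    forall N d, (size u <= N.+1)%N -> 0 <= d -> diam_le u d ->
      diam_le t ((N%:R / N.+1%:R) ^+ r * d)].
Proof.
elim: r t => [|r IH] t /=.
  by move=> tc; exists t => //; split=> // N d _ _ dt; rewrite mul1r.
case/sdc_mem => t' /IH[u uc [sz Cu du]] tt'; exists u => //; split.
- by rewrite (size_sd tt').
- by move=> C Cb Cu' v; apply: sd_closed tt' v => //; exact: Cu.
- move=> N d szu d0 dd; rewrite exprS -mulrA.
  apply: diam_sd tt' => //; rewrite ?sz //; last exact: du.
  by rewrite mulr_ge0 // exprn_ge0 // divr_ge0.
Qed.
End Diameter.

(** * Caratheodory's theorem *)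

Section Caratheodory.
Variables (R : realFieldType) (d : nat) (I : finType) (a : I -> 'rV[R]_d).
Implicit Types (w : I -> R).

(** After appending a coordinate 1 to each point, more than [d + 1] vectors in dimension [d + 1] are
    dependent. The coefficients sum to zero and are not all zero, so one is positive. *)
Lemma affine_dependence (S : {set I}) : (d.+1 < #|S|)%N ->
  exists mu : I -> R, [/\ forall i, i \notin S -> mu i = 0, exists i, mu i > 0,
    \sum_i mu i = 0 & \sum_i mu i *: a i = 0].
Proof.
move=> dS; pose A := \matrix_(x < #|S|) row_mx (a (enum_val x)) (const_mx 1 : 'rV_1).
have : kermx A != 0.
  by rewrite -mxrank_eq0 mxrank_ker subn_eq0 -ltnNge (leq_ltn_trans (rank_leq_col _)) // addn1.
case/rowV0Pn => v /sub_kermxP vA v0.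
have [i0 i0S] : exists i, i \in S by apply/card_gt0P; apply: leq_trans dS.
pose mu i : R := if i \in S then v 0 (enum_rank_in i0S i) else 0.
have mu_sum (M : lmodType R) (f : I -> M) :
    \sum_i mu i *: f i = \sum_x v 0 x *: f (enum_val x).
  rewrite (bigID (mem S)) /= [X in _ + X]big1 ?addr0; last first.
    by move=> i /negPf iS; rewrite /mu iS scale0r.
  rewrite big_enum_val /=; apply: eq_bigr => x _.
  by rewrite /mu enum_valP enum_valK_in.
have vA0 z : \sum_x v 0 x * A x z = 0.
  by have := congr1 (fun M : 'rV_(d + 1) => M 0 z) vA; rewrite !mxE.
have mua : \sum_i mu i *: a i = 0.
  rewrite mu_sum; apply/rowP => y; rewrite summxE mxE -[RHS](vA0 (lshift 1 y)).
  by apply: eq_bigr => x _; rewrite mxE [A _ _]mxE row_mxEl.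
have mu1 : \sum_i mu i = 0.
  rewrite -[RHS](vA0 (rshift d ord0)).
  have := mu_sum R^o (fun=> 1); under eq_bigr do rewrite [_ *: _]mulr1.
  by move=> ->; apply: eq_bigr => x _; rewrite [A _ _]mxE row_mxEr mxE.
have muS i : i \notin S -> mu i = 0 by rewrite /mu => /negPf ->.
exists mu; split=> //; apply: contrapT => mule.
have mu0 i : mu i = 0.
  have le0 j : mu j <= 0 by rewrite leNgt; apply/negP => j0; apply: mule; exists j.
  apply/eqP; rewrite -oppr_eq0.
  have : \sum_j - mu j == 0 by rewrite sumrN mu1 oppr0.
  rewrite psumr_eq0 => [/allP/(_ i)|j _]; last by rewrite oppr_ge0.
  by rewrite mem_index_enum => /(_ isT).
case/negP: v0; apply/eqP/rowP => x; rewrite mxE.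
by have := mu0 (enum_val x); rewrite /mu enum_valP enum_valK_in.
Qed.

Lemma caratheodory_support w : (forall i, 0 <= w i) -> 0 < \sum_i w i ->
  \sum_i w i *: a i = 0 ->
  exists w', [/\ forall i, 0 <= w' i, 0 < \sum_i w' i, \sum_i w' i *: a i = 0,
    forall i, 0 < w' i -> 0 < w i & (#|[set i | (0 < w' i)%R]| <= d.+1)%N].
Proof.
have [N] := ubnP #|[set i | (0 < w i)%R]|; elim: N w => // N IH w SN w0 wpos wa.
have [|dS] := leqP #|[set i | (0 < w i)%R]| d.+1; first by exists w.
have [mu [muS [i1 mu1] smu mua]] := affine_dependence dS.
have [i0 mui0 mini0] := @Order.TotalTheory.arg_minP _ _ I i1 (fun i => 0 < mu i) (fun i => w i / mu i) mu1.
(* The largest multiple of [mu] whose subtraction keeps the weights nonnegative; it makes the weight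
   of [i0] vanish. *)
pose t := w i0 / mu i0; have t0 : 0 <= t by rewrite divr_ge0 // ltW.
pose w' i := w i - t * mu i.
have w'0 i : 0 <= w' i.
  rewrite subr_ge0; have [mi|mi] := ltP 0 (mu i).
    by rewrite -ler_pdivlMr //; exact: mini0.
  by apply: le_trans (w0 i); rewrite mulr_ge0_le0.
have sub : [set i | (0 < w' i)%R] \proper [set i | (0 < w i)%R].
  apply/properP; split.
    apply/fintype.subsetP => i; rewrite !inE; apply: contraLR => wi.
    rewrite /w' muS ?inE // mulr0 subr0 //.
  exists i0; rewrite !inE.
    by apply: contraLR mui0 => wi; rewrite muS ?inE // ltxx.
  by rewrite /w' /t divfK ?subrr ?ltxx // gt_eqF.
have [||||w'' [w''0 w''pos w''a w''w w''d]] := IH w'.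
- by apply: leq_trans (proper_card sub) _; rewrite -ltnS.
- by [].
- by rewrite sumrB -mulr_sumr smu mulr0 subr0.
- under eq_bigr do rewrite scalerBl -scalerA.
  by rewrite sumrB wa -scaler_sumr mua scaler0 subr0.
exists w''; split=> // i /w''w; have := proper_sub sub.
by move=> /fintype.subsetP /(_ i); rewrite !inE.
Qed.

Lemma caratheodory0 w : (forall i, 0 <= w i) -> 0 < \sum_i w i ->
  \sum_i w i *: a i = 0 ->
  exists (c : 'I_d.+1 -> R) (f : 'I_d.+1 -> I), [/\ forall x, 0 <= c x,
    forall x, 0 < w (f x), \sum_x c x = 1 & \sum_x c x *: a (f x) = 0].
Proof.
move=> w0 wpos wa; have [w' [w'0 w'pos w'a w'w w'd]] := caratheodory_support w0 wpos wa.
set S := [set i | _] in w'd.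
have w'S i : i \notin S -> w' i = 0.
  by rewrite inE -leNgt => w'i; apply/eqP; rewrite eq_le w'i w'0.
have [i0 i0S] : exists i, i \in S.
  apply: contrapT => S0; move: w'pos; rewrite big1 ?ltxx // => i _.
  by apply: w'S; apply/negP => iS; apply: S0; exists i.
pose W := \sum_i w' i.
(* Beyond the support, [f] repeats [i0] with coefficient 0, to give exactly [d + 1] points. *)
pose f (x : 'I_d.+1) := nth i0 (enum S) x.
pose c (x : 'I_d.+1) := if (x < #|S|)%N then w' (f x) / W else 0.
have fS x : f x \in S.
  rewrite /f; have [xS|xS] := ltnP x (size (enum S)); last by rewrite nth_default.
  by rewrite -mem_enum mem_nth.
have sumc (M : lmodType R) (g : I -> M) :
    \sum_x c x *: g (f x) = W^-1 *: \sum_i w' i *: g i.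
  rewrite (bigID (mem S)) /= [X in _ + X]big1 ?addr0; last first.
    by move=> i /w'S ->; rewrite scale0r.
  rewrite -[in RHS]big_enum /= (big_nth i0) big_mkord -cardE scaler_sumr.
  rewrite (big_ord_widen d.+1 (fun x => W^-1 *: (w' (nth i0 (enum S) x) *: g (nth i0 (enum S) x)))) //.
  rewrite [RHS]big_mkcond; apply: eq_bigr => x _; rewrite /c -/(f x).
  by case: ifP => _; rewrite ?scale0r // scalerA mulrC.
exists c, f; split.
- by move=> x; rewrite /c; case: ifP => // _; rewrite divr_ge0 // ltW.
- by move=> x; apply: w'w; have := fS x; rewrite inE.
- have := sumc R^o (fun=> 1); under eq_bigr do rewrite [_ *: _]mulr1.
  move=> ->; under eq_bigr do rewrite [_ *: _]mulr1.
  by rewrite [_ *: _]mulVf // gt_eqF.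
- by rewrite sumc w'a scaler0.
Qed.
End Caratheodory.

Local Open Scope classical_set_scope.
Local Open Scope ring_scope.

(** * Common zeros of equivariant functions *)

Section Octahedra.
Variables (R : realType) (n k : nat).
Notation V := 'M[R]_(k, n).
Implicit Types (u v : V) (j : 'I_k) (l : 'I_n) (m : {ffun 'I_k -> nat}).

Definition flip j : {linear V -> V} := mulmx (diag_mx (\row_i (-1) ^+ (i == j))).

Lemma flipE j u i l : flip j u i l = (-1) ^+ (i == j) * u i l.
Proof. by rewrite /flip /= mul_diag_mx !mxE. Qed.

Lemma flipK j : involutive (flip j).
Proof. by move=> u; apply/matrixP => i l; rewrite !flipE signrMK. Qed.

Lemma flipC i j u : flip i (flip j u) = flip j (flip i u).
Proof. by apply/matrixP => x l; rewrite !flipE mulrCA. Qed.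

(** Unit spheres of the 1-norm are polyhedral, so their product can be triangulated by affine
    simplices. *)
Definition octa : set V := [set u | forall j, \sum_l `|u j l| = 1].

(** A product of faces of the octahedra: for fixed signs [b] the 1-norm is linear, which gives
    convexity. *)
Definition cell (b : 'I_k -> 'I_n -> bool) : set V :=
  [set u | forall j, (forall l, 0 <= (-1) ^+ b j l * u j l) /\
                     \sum_l (-1) ^+ b j l * u j l = 1].

Lemma cell_octa b u : cell b u -> octa u.
Proof.
move=> bu j; have [b0 <-] := bu j; apply: eq_bigr => l _.
by rewrite -[RHS]ger0_norm // normrM normr_sign mul1r.
Qed.

Lemma bary_closed_cell b : bary_closed (cell b).
Proof.
move=> t t0 tb j; have sz0 : (0 : R) < (size t)%:R by rewrite ltr0n lt0n size_eq0.
have E l : (-1) ^+ b j l * bary t j l =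
    (size t)%:R^-1 * \sum_(v <- t) (-1) ^+ b j l * v j l.
  by rewrite /bary mxE summxE mulrCA mulr_sumr.
split=> [l|].
  rewrite E; apply: mulr_ge0; first by rewrite invr_ge0 ltW.
  by rewrite big_seq; apply: sumr_ge0 => v /tb /(_ j) [].
under eq_bigr do rewrite E; rewrite -mulr_sumr exchange_big /= big_seq.
rewrite (eq_bigr (fun=> 1)); last by move=> v /tb /(_ j) [].
rewrite -big_seq big_const_seq count_predT iter_addr_0 mulVf // gt_eqF //.
Qed.

Lemma cell_ext (b b' : 'I_k -> 'I_n -> bool) u u' :
  (forall j l, (-1) ^+ b' j l * u' j l = (-1) ^+ b j l * u j l) ->
  cell b u -> cell b' u'.
Proof.
move=> e bu j; have [b0 b1] := bu j.
by split=> [l|]; [rewrite e | under eq_bigr do rewrite e].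
Qed.

(** Row [j] is the pole of the hemisphere of dimension [m j] in the first [m j + 1] coordinates. *)
Definition apex m : V := \matrix_(j, l) (l == m j :> nat)%:R.

Definition bounded m := [forall j, (m j < n)%N].

Lemma bounded_dec j m : bounded m -> bounded (dec j m).
Proof.
by move/forallP => mn; apply/forallP => i; rewrite ffunE; apply: leq_ltn_trans (mn i); rewrite leq_subr.
Qed.

Notation hemi := (hemi flip apex).

(** The induction records that coordinates beyond [m j] vanish and that the sign at [m j] is
    positive, so that the next apex fits into a common cell. *)
Lemma hemi_cell N m t : bounded m -> t \in hemi N m ->
  size t = N.+1 /\ exists b, (forall j l, l = m j :> nat -> b j l = false) /\
    forall u, u \in t -> cell b u /\ forall j l, (m j < l)%N -> u j l = 0.
Proof.
have cell_apex (m' : {ffun 'I_k -> nat}) b' : bounded m' ->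
  (forall j l, l = m' j :> nat -> b' j l = false) -> cell b' (apex m').
  move=> /forallP mn b'0 j; split=> [l|].
    by rewrite mxE; case: eqP => [/b'0 ->|_]; rewrite ?mulr1 // mulr0.
  rewrite (bigD1 (Ordinal (mn j))) //= mxE eqxx b'0 // mulr1 big1 ?addr0 // => l.
  by rewrite -val_eqE mxE /= => /negPf ->; rewrite mulr0.
have apex0 m' j l : (m' j < l)%N -> apex m' j l = 0.
  by rewrite mxE => ml; rewrite gtn_eqF.
elim: N m t => [|N IH] m t bm.
  rewrite inE => /eqP ->; split=> //; exists (fun _ _ => false); split=> // u.
  by rewrite inE => /eqP ->; split; [exact: cell_apex|exact: apex0].
have step t' j b' : (0 < m j)%N -> size t' = N.+1 ->
  (forall i l, i != j -> l = m i :> nat -> b' i l = false) ->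
  (forall u, u \in t' -> cell b' u /\ forall i l, (dec j m i < l)%N -> u i l = 0) ->
  size (apex m :: t') = N.+2 /\ exists b, (forall j l, l = m j :> nat -> b j l = false) /\
    forall u, u \in apex m :: t' -> cell b u /\ forall j l, (m j < l)%N -> u j l = 0.
  move=> mj szt' b'0 tb'; split; first by rewrite /= szt'.
  (* On row [j] the coordinate [m j] vanishes on [t'], so its sign may be reset to suit the apex. *)
  pose b i l := if l == m i :> nat then false else b' i l.
  have b0 i l : l = m i :> nat -> b i l = false by rewrite /b => ->; rewrite eqxx.
  exists b; split=> // u; rewrite inE => /orP[/eqP ->|/tb' [ub' u0]].
    by split; [exact: cell_apex|exact: apex0].
  split=> [|i l mil]; last by apply: u0; rewrite ffunE (leq_ltn_trans (leq_subr _ _) mil).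
  apply: cell_ext ub' => i l; rewrite /b; case: eqP => // lmi.
  have [ij|ij] := eqVneq i j; last by rewrite b'0.
  by rewrite u0 ?mulr0 // ij ffunE eqxx lmi ij; lia.
rewrite [t \in _]/= => /mapP[t' /flattenP[c /mapP[j]]].
rewrite mem_filter => /andP[mj _] -> ct' ->.
move: ct'; rewrite mem_cat => /orP[|/mapP[t1]] /(IH _ _ (bounded_dec j bm)) [szt [b' [b'0 tb']]].
  apply: (step _ j b') => // i l ij e; apply: b'0.
  by rewrite ffunE (negPf ij) subn0.
move=> ->.
(* The flip of row [j] negates the signs of that row. *)
apply: (step _ j (fun i l => if i == j then ~~ b' i l else b' i l)) => //.
- by rewrite size_map.
- move=> i l ij e; rewrite (negPf ij); apply: b'0.
  by rewrite ffunE (negPf ij) subn0.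
- move=> _ /mapP[u /tb' [ub u0] ->]; split=> [|i l /u0 e].
    apply: cell_ext ub => i l; rewrite flipE.
    by case: (i == j); rewrite ?signrN ?mulN1r ?mulrNN ?mul1r.
  by rewrite -/(flip j u) (flipE j u) e mulr0.
Qed.

End Octahedra.

(** * Continuity of sums and compactness of the product of octahedra *)

Lemma cvg_sumv (R : realType) (V : normedModType R) (T : topologicalType) (I : Type)
    (r : seq I) (f : I -> T -> V) (x : T) :
  (forall i, {for x, continuous (f i)}) ->
  {for x, continuous (fun u => \sum_(i <- r) f i u)}.
Proof.
move=> fx; change (\sum_(i <- r) f i u @[u --> x] --> \sum_(i <- r) f i x).
elim: r => [|i r IH].
  by rewrite big_nil; under eq_cvg do rewrite big_nil; exact: cvg_cst.
rewrite big_cons; under eq_cvg do rewrite big_cons.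
by apply: (@cvgD _ _ _ _ _ (f i)); [exact: fx|exact: IH].
Qed.

Lemma cvg_sumr (R : realType) (T : topologicalType) (I : Type) (r : seq I)
    (f : I -> T -> R) (x : T) :
  (forall i, {for x, continuous (f i)}) ->
  {for x, continuous (fun u => \sum_(i <- r) f i u)}.
Proof. exact: (@cvg_sumv R R^o). Qed.

Section OctaCompact.
Variables (R : realType) (n k : nat).

Lemma vec_mx_continuous : continuous (vec_mx : 'rV[R]_(k * n) -> 'M[R]_(k, n)).
Proof.
move=> v; apply/(@cvg_ballP _ _ _ _ (nbhs_filter v)) => e e0.
apply: filterS (nbhsx_ballx v e e0) => w [_ vw].
by split=> // i j; rewrite !mxE; exact: vw.
Qed.

Lemma octa_compact : compact (@octa R n k).
Proof.
pose cube := [set v : 'rV[R]_(k * n) | forall i, v ord0 i \in `[(-1), 1]].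
have cube_compact : compact cube.
  by apply: (@rV_compact R _ (fun=> `[(-1), 1]%classic)) => _; exact: segment_compact.
apply: (@subclosed_compact _ _ (vec_mx @` cube)).
- have -> : @octa R n k = \bigcap_(j in [set: 'I_k])
      ((fun u : 'M[R]_(k, n) => \sum_l `|u j l|) @^-1` [set x | x = 1]).
    by apply/seteqP; split=> u uo j; [move=> _|]; exact: uo.
  apply: closed_bigI => j _; apply: preimage_closed; last exact: closed_eq.
  move=> u _; apply: cvg_sumr => l.
  apply: (@continuous_comp _ _ _ (fun u : 'M[R]_(k, n) => u j l) Num.norm).
    exact: coord_continuous.
  exact: norm_continuous.
- apply: continuous_compact => //; apply: continuous_subspaceT => v.
  exact: vec_mx_continuous.
- move=> u uo; exists (mxvec u); last by rewrite mxvecK.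
  move=> i; case/mxvec_indexP: i => j l; rewrite mxvecE in_itv /= -ler_norml -(uo j).
  by rewrite (bigD1 l) //= lerDl sumr_ge0.
Qed.
End OctaCompact.

Section RowSign.
Variables (R : realType) (n k : nat).
Implicit Types (u : 'M[R]_(k, n)) (i j : 'I_k).

(* A sign for a nonzero row; only its equivariance matters, it decides ties
   [F i u = 0] below. *)
Definition row_sign j u : bool :=
  if [pick l | u j l != 0] is Some l then u j l < 0 else false.

Definition rows_neq0 u := [forall j, [exists l, u j l != 0]].

Lemma octa_rows_neq0 u : octa u -> rows_neq0 u.
Proof.
move=> uo; apply/forallP => j; apply: contraT => /existsPn u0.
have := uo j; rewrite big1 => [/eqP|l _]; first by rewrite eq_sym oner_eq0.
by have := u0 l; rewrite negbK => /eqP ->; rewrite normr0.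
Qed.

Lemma row_sign_flip i j u : rows_neq0 u ->
  row_sign i (flip R n j u) = row_sign i u (+) (i == j).
Proof.
move=> /forallP /(_ i) /existsP [l0 ul0]; rewrite /row_sign.
have e l : (flip R n j u i l != 0) = (u i l != 0).
  by rewrite flipE mulf_eq0 signr_eq0.
rewrite (eq_pick e); case: pickP => [l ul|/(_ l0)]; last by rewrite ul0.
rewrite flipE; case: (i == j); rewrite ?mul1r ?addbF // mulN1r oppr_lt0 addbT.
by rewrite ltNge le_eqVlt (negPf ul).
Qed.
End RowSign.

(** * From simplices with both signs to a common zero *)

Section CommonZero.
Variables (R : realType) (n k : nat).
Variables (I : eqType) (ch : I -> 'I_k * 'I_k) (F : I -> 'M[R]_(k, n) -> R).
Hypothesis ch_le : forall i, ((ch i).1 <= (ch i).2)%N.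
Hypothesis F_continuous : forall i u, octa u -> {for u, continuous (F i)}.
Hypothesis F_flip : forall i j u, rows_neq0 u ->
  F i (flip R n j u) = (-1) ^+ chi ch i j * F i u.

(** On the zero set of [F i] the row signs supply a value with the same character, so that
    [sgn_flip] holds there too. For equal indices a single row sign is taken, since two would
    cancel. *)
Definition sgn i u : 'F_2 :=
  (if F i u == 0 then row_sign (ch i).1 u (+) (((ch i).1 != (ch i).2) && row_sign (ch i).2 u)
   else F i u < 0)%:R.

Lemma natF2_addb (a b : bool) : (a (+) b)%:R = a%:R + b%:R :> 'F_2.
Proof. by case: a; case: b; rewrite /= ?addF2 ?addr0 ?add0r. Qed.

Lemma sgn_flip i j u : rows_neq0 u ->
  sgn i (flip R n j u) = sgn i u + (chi ch i j)%:R.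
Proof.
move=> u0; rewrite -natF2_addb /sgn F_flip // mulf_eq0 signr_eq0 /=; congr (_ %:R).
case: eqVneq => [_|Fu]; last first.
  case: (chi _ _ _); rewrite ?mul1r ?addbF // mulN1r oppr_lt0 addbT.
  by rewrite ltNge le_eqVlt (negPf Fu).
rewrite !row_sign_flip // /chi [j == (ch i).1]eq_sym [j == (ch i).2]eq_sym.
case: (eqVneq (ch i).1 (ch i).2) => [<-|ne] /=; first by rewrite !addbF orbb.
have : ~~ (((ch i).1 == j) && ((ch i).2 == j)).
  by apply: contra ne => /andP[/eqP -> /eqP ->].
by do 2!case: (_ == j); do 2!case: (row_sign _ _).
Qed.

Lemma octa_norm (u : 'M[R]_(k, n)) : octa u -> `|u| <= 1.
Proof.
move=> uo; rewrite /Num.norm /= mx_normrE; apply/bigmax_leP; split=> // -[j l] _ /=.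
by rewrite -(uo j) (bigD1 l) //= lerDl sumr_ge0.
Qed.

(** By [coef_content] the cup product has value 1 on the [r]-fold subdivided chain, so it is nonzero
    on some simplex, where every factor then takes both signs. The initial diameter is at most 2
    because [octa] lies in the unit ball. *)
Lemma small_alternating_simplex L r : (0 < n)%N ->
  (forall j : 'I_k, count (fun i => (ch i).1 == j) L = (n.-1 - j)%N) ->
  exists t : seq 'M[R]_(k, n), [/\ (0 < size t)%N, forall u, u \in t -> octa u,
    diam_le t (((size L)%:R / (size L).+1%:R) ^+ r * 2) &
    forall i, i \in L -> exists u v, [/\ u \in t, v \in t & sgn i u != sgn i v]].
Proof.
move=> n0 cont; pose m : {ffun 'I_k -> nat} := [ffun j : 'I_k => (n.-1 - j)%N].
pose h (N : nat) (m' : {ffun 'I_k -> nat}) := iter r (@sdc R 'M[R]_(k, n)) (hemi (@flip R n k) (@apex R n k) N m').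
have hres : resolution (@flip R n k) h.
  rewrite /h; elim: (r) => [|r' IH] /=.
    by apply: hemi_resolution => [j|i j v]; [exact: flipK|exact: flipC].
  exact: (resolution_sdc IH).
have hmem N m' t : bounded n m' -> t \in h N m' -> [/\ size t = N.+1,
    forall u, u \in t -> octa u & diam_le t ((N%:R / N.+1%:R) ^+ r * 2)].
  move=> bm' /iter_sdc_mem [t0 /(hemi_cell bm') [szt0 [b [_ t0b]]] [szt tC tD]].
  have t0o u : u \in t0 -> octa u by case/t0b => /cell_octa.
  split; first by rewrite szt.
    move=> u ut; apply: (@cell_octa _ _ _ b); apply: tC ut; first exact: bary_closed_cell.
    by move=> v /t0b [].
  apply: tD; rewrite ?szt0 // => u v /t0o uo /t0o vo.
  by apply: le_trans (ler_normB _ _) _; rewrite -[2]/(1 + 1); apply: lerD; exact: octa_norm.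
have bm : bounded n m.
  by apply/forallP => j; rewrite ffunE; apply: leq_ltn_trans (leq_subr _ _) _; rewrite prednK.
have sm : (\sum_j m j = size L)%N.
  transitivity (\sum_j count (fun i => (ch i).1 == j) L)%N.
    by apply: eq_bigr => j _; rewrite ffunE cont.
  elim: (L) => [|i L' IH] /=; first by rewrite big1.
  rewrite big_split /= IH (bigD1 (ch i).1) //= eqxx big1 ?addn0 // => j.
  by rewrite eq_sym => /negPf ->.
have : ev (Phi sgn L) (h (size L) m) != 0.
  rewrite (Phi_resolution (g := @flip R n k) (ch := ch) (D := @rows_neq0 R n k)
    (P := @bounded n k)) ?(coef_content ch_le) ?oner_eq0 //.
  - by move=> j; rewrite ffunE cont.
  - by move=> j m'; exact: bounded_dec.
  - by move=> i j v; exact: sgn_flip.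
  - move=> m'; have -> : h 0%N m' = [:: [:: apex R n m']].
      rewrite /h; elim: (r) => //= r' ->; rewrite /sdc /= /sd /= /bary big_seq1.
      by rewrite invr1 scale1r.
    by rewrite ev_cons ev_nil addr0.
  - move=> N m' t bm' /(hmem _ _ _ bm') [szt to _]; split=> //.
    by apply/allP => u /to /octa_rows_neq0.
case/ev_neq0 => t /(hmem _ _ _ bm) [szt to td] nz; exists t; split=> //.
  by rewrite szt.
by move=> i; exact: Phi_neq0.
Qed.

Theorem common_zero L : (0 < n)%N ->
  (forall j : 'I_k, count (fun i => (ch i).1 == j) L = (n.-1 - j)%N) ->
  exists2 u, octa u & forall i, i \in L -> F i u = 0.
Proof.
move=> n0 cont.
have /choice [t ht] := fun r => small_alternating_simplex r n0 cont.
pose lam : R := (size L)%:R / (size L).+1%:R.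
have lam0 : 0 <= lam by rewrite divr_ge0.
have lam1 : `|lam| < 1.
  by rewrite ger0_norm // ltr_pdivrMr ?ltr0n // mul1r ltr_nat.
pose x r := head 0 (t r).
have xt r : x r \in t r.
  by have [] := ht r; rewrite /x; case: (t r) => // a s _ _ _ _; exact: mem_head.
have [u [uo ucl]] : octa (k := k) `&` cluster (x @ \oo) !=set0.
  apply: octa_compact; exists 0%N => // r _ /=.
  by have [_ to _ _] := ht r; exact: to.
exists u => // i iL; apply/eqP/contraT => Fu.
have Fuc := @F_continuous i u uo.
(* If [F i u] is nonzero, [F i] keeps its sign near [u], and a small simplex near [u] cannot see
   both signs. *)
have /nbhs_ballP [e /= e0 ue] : nbhs u [set v | 0 < F i u * F i v].
  have : {for u, continuous (fun v => F i u * F i v)}.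
    by apply: (@continuousM R _ (fun=> F i u) (F i)) => //; exact: cst_continuous.
  move/(_ [set y | 0 < y]); apply; apply: open_nbhs_nbhs; split; first exact: open_gt.
  by rewrite /= -expr2 exprn_even_gt0.
have [N _ small] : \forall r \near \oo, lam ^+ r * 2 < e / 2.
  have : (fun r => lam ^+ r) @ \oo --> (0 : R) by exact: cvg_expr.
  move/cvgrPdist_lt => /(_ (e / 4)); rewrite divr_gt0 // => /(_ isT).
  by apply: filterS => r; rewrite sub0r normrN ger0_norm ?exprn_ge0 //; lra.
(* A cluster point is approached at arbitrarily late indices, hence at some [r] for which [t r] has
   diameter below [e / 2]. *)
have [_ [[r Nr <-] xru]] : [set x r | r in [set r | (N <= r)%N]] `&` ball u (e / 2) !=set0.
  apply: ucl; first by exists N => // r Nr; exists r.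
  by apply: nbhsx_ballx; rewrite divr_gt0.
have [_ _ td alt] := ht r.
have pos v : v \in t r -> 0 < F i u * F i v.
  move=> vt; apply: ue; rewrite [e]splitr; apply: ball_triangle xru _.
  rewrite -ball_normE /ball_ /=; apply: le_lt_trans (td _ _ (xt r) vt) _.
  exact: small.
have [v [w [vt wt]]] := alt i iL.
have sgnE z : z \in t r -> sgn i z = (F i u < 0)%R%:R.
  move/pos => uz; rewrite /sgn; case: eqP uz => [->|_ uz]; first by rewrite mulr0 ltxx.
  congr (_%:R); case: (ltgtP (F i u) 0) Fu uz => // Fu _ uz.
    by move: uz; rewrite nmulr_rgt0 // => ->.
  by move: uz; rewrite pmulr_rgt0 // => /ltW; rewrite leNgt => /negPf ->.
by rewrite !sgnE // eqxx.
Qed.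
End CommonZero.

(** * Compactness of convex hulls *)

Lemma rV_entry_continuous (T : topologicalType) m (i : 'I_m) :
  continuous (fun v : 'rV[T]_m => v ord0 i).
Proof.
move=> v A vA; exists (fun x y => if (x == ord0) && (y == i) then A else setT).
  by move=> x y /=; case: ifP => [/andP[/eqP -> /eqP ->]//|_]; exact: filterT.
by move=> w /(_ ord0 i); rewrite !eqxx.
Qed.

Lemma convm_compact (R : realType) (n m : nat) (X : set 'rV[R]_n) :
  compact X -> compact (convm m X).
Proof.
move=> Xc; pose W := [set w : 'rV[R]_m | forall i, w ord0 i \in `[0, 1]].
pose Y := [set y : 'rV['rV[R]_n]_m | forall i, X (y ord0 i)].
have Wc : compact W.
  by apply: (@rV_compact R m (fun=> `[0, 1]%classic)) => _; exact: segment_compact.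
have Yc : compact Y by exact: (@rV_compact _ m (fun=> X)).
pose S := [set v : 'rV[R]_m * 'rV['rV[R]_n]_m | \sum_i v.1 ord0 i = 1].
have wc i : continuous (fun v : 'rV[R]_m * 'rV['rV[R]_n]_m => v.1 ord0 i).
  move=> v; apply: (@continuous_comp _ _ _ fst (fun w : 'rV[R]_m => w ord0 i)).
    exact: cvg_fst.
  exact: rV_entry_continuous.
have yc i : continuous (fun v : 'rV[R]_m * 'rV['rV[R]_n]_m => v.2 ord0 i).
  move=> v; apply: (@continuous_comp _ _ _ snd (fun y : 'rV['rV[R]_n]_m => y ord0 i)).
    exact: cvg_snd.
  exact: rV_entry_continuous.
have Sc : closed S.
  apply: (@preimage_closed _ _ (fun v : 'rV[R]_m * 'rV['rV[R]_n]_m => \sum_i v.1 ord0 i)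
    [set x | x = 1]); last exact: closed_eq.
  by move=> v _; apply: cvg_sumr => i; exact: wc.
have -> : convm m X = (fun v : 'rV[R]_m * 'rV['rV[R]_n]_m =>
    \sum_i v.1 ord0 i *: v.2 ord0 i) @` ((W `*` Y) `&` S).
  apply/seteqP; split=> [x [w [y [Xy [w0 [w1 ->]]]]]|_ [v [[Wv Yv] Sv] <-]].
    exists (\row_i w i, \row_i y i); last by apply: eq_bigr => i _; rewrite !mxE.
    split; last by rewrite /S /= -w1; apply: eq_bigr => i _; rewrite mxE.
    split=> i /=; rewrite mxE //= in_itv /= w0 -w1 (bigD1 i) //= lerDl.
    by rewrite sumr_ge0.
  exists (fun i => v.1 ord0 i), (fun i => v.2 ord0 i).
  by do ! split=> //; move=> i; have := Wv i; rewrite in_itv => /andP[].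
apply: continuous_compact; last by apply: compact_closedI => //; exact: compact_setX.
apply: continuous_subspaceT => v; apply: (@cvg_sumv R) => i.
by apply: continuousZ; [exact: wc|exact: yc].
Qed.

Lemma compact_net (R : realType) (V : normedModType R) (X : set V) (e : R) :
  compact X -> 0 < e ->
  exists s : seq V, (forall y, y \in s -> X y) /\
    forall x, X x -> exists2 y, y \in s & `|y - x| < e.
Proof.
rewrite compact_cover => Xc e0.
have [|x Xx|D DX XD] := Xc V X (fun y => ball y e).
- by move=> y _; exact: ball_open.
- by exists x => //; exact: ballxx.
exists (finmap.enum_fset D); split=> [y yD|x /XD[y yD xy]].
  exact: set_mem (DX _ yD).
by exists y => //; rewrite -ball_normE in xy.
Qed.

(** * Orthogonal frames *)

Section Residual.
Variables (R : realType) (n k : nat).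
Implicit Types (z : 'rV[R]_n) (u : 'M[R]_(k, n)) (j : 'I_k) (l : 'I_n).

Definition dotr z u j : R := \sum_l z 0 l * u j l.

Definition nrm2 u j : R := \sum_l u j l ^+ 2.

(* If the rows of [u] are nonzero and orthogonal, this is the component of [z]
   orthogonal to their span; for every [u] it is invariant under [flip]. *)
Definition resid z u l : R := z 0 l - \sum_j dotr z u j / nrm2 u j * u j l.

Definition dist2 z u : R := \sum_l resid z u l ^+ 2.

Definition weight (eta : R) z u : R := Num.max 0 (eta - dist2 z u).

Lemma dotr_flip z u i j : dotr z (flip R n j u) i = (-1) ^+ (i == j) * dotr z u i.
Proof. by rewrite /dotr mulr_sumr; apply: eq_bigr => l _; rewrite flipE mulrCA. Qed.

Lemma nrm2_flip u i j : nrm2 (flip R n j u) i = nrm2 u i.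
Proof. by apply: eq_bigr => l _; rewrite flipE exprMn sqrr_sign mul1r. Qed.

Lemma resid_flip z u j l : resid z (flip R n j u) l = resid z u l.
Proof.
congr (_ - _); apply: eq_bigr => i _.
rewrite dotr_flip nrm2_flip flipE.
by case: (i == j); rewrite ?mul1r // !mulN1r !mulNr mulrN opprK.
Qed.

Lemma weight_flip eta z u j : weight eta z (flip R n j u) = weight eta z u.
Proof.
by rewrite /weight /dist2; congr (Num.max _ (_ - _)); apply: eq_bigr => l _; rewrite resid_flip.
Qed.

Lemma nrm2_neq0 u j : octa u -> nrm2 u j != 0.
Proof.
move/octa_rows_neq0/forallP/(_ j)/existsP => [l ul].
rewrite psumr_neq0 => [|x _]; last by rewrite sqr_ge0.
by apply/hasP; exists l; rewrite ?mem_index_enum //= exprn_even_gt0.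
Qed.

Section Continuity.
Variable u0 : 'M[R]_(k, n).
Hypothesis u0_octa : octa u0.
Let cont (f : 'M[R]_(k, n) -> R) := {for u0, continuous f}.

Let cont_cst c : cont (fun=> c).
Proof. exact: cst_continuous. Qed.

Let contM f g : cont f -> cont g -> cont (fun u => f u * g u).
Proof. by move=> cf cg; apply: (@continuousM R _ f g). Qed.

Let contB f g : cont f -> cont g -> cont (fun u => f u - g u).
Proof. by move=> cf cg; apply: (@continuousB R R^o _ f g). Qed.

Let cont_entry j l : cont (fun u => u j l).
Proof. exact: coord_continuous. Qed.

Let cont_dotr z j : cont (fun u => dotr z u j).
Proof. by apply: cvg_sumr => l; apply: contM. Qed.

Let cont_nrm2 j : cont (fun u => nrm2 u j).
Proof. by apply: cvg_sumr => l; apply: contM. Qed.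

Let cont_resid z l : cont (fun u => resid z u l).
Proof.
apply: contB; first exact: cont_cst.
apply: cvg_sumr => j; apply: contM => //; apply: contM => //.
by apply: (@continuousV R _ (fun u => nrm2 u j)); [exact: nrm2_neq0|exact: cont_nrm2].
Qed.

Lemma weight_dotr_continuous eta z j :
  {for u0, continuous (fun u => weight eta z u * dotr z u j)}.
Proof.
apply: contM; last exact: cont_dotr.
apply: (@continuous_max R _ (fun=> 0) (fun u => eta - dist2 z u)).
  exact: cont_cst.
by apply: contB; [exact: cont_cst|apply: cvg_sumr => l; apply: contM].
Qed.

Lemma row_dot_continuous i j :
  {for u0, continuous (fun u => \sum_l u i l * u j l)}.
Proof. by apply: cvg_sumr => l; apply: contM. Qed.
End Continuity.

Definition orthogonal_rows u := forall i j, i != j -> \sum_l u i l * u j l = 0.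

Section Orthogonal.
Variable u : 'M[R]_(k, n).
Hypotheses (uo : octa u) (u_orth : orthogonal_rows u).

Lemma dot_rows i j : \sum_l u i l * u j l = if i == j then nrm2 u j else 0.
Proof. by case: eqVneq => [->//|/u_orth]. Qed.

Lemma sum_rows (c : 'I_k -> R) j :
  \sum_l (\sum_i c i * u i l) * u j l = c j * nrm2 u j.
Proof.
under eq_bigr do rewrite mulr_suml; rewrite exchange_big /= (bigD1 j) //=.
rewrite [X in _ + X]big1 ?addr0 => [|i /negPf ij].
  by rewrite mulr_sumr; apply: eq_bigr => l _; rewrite -mulrA.
by under eq_bigr do rewrite -mulrA; rewrite -mulr_sumr dot_rows ij mulr0.
Qed.

Lemma resid_orth z j : \sum_l resid z u l * u j l = 0.
Proof.
under eq_bigr do rewrite mulrBl; rewrite sumrB -/(dotr z u j).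
by rewrite (sum_rows (fun i => dotr z u i / nrm2 u i)) divfK ?nrm2_neq0 // subrr.
Qed.

(** Pythagoras for the splitting of [z] into its residual and its projection [pi] to the span of the
    rows. *)
Lemma dist2_le z : dist2 z u <= \sum_l z 0 l ^+ 2.
Proof.
pose pi l := \sum_j dotr z u j / nrm2 u j * u j l.
have -> : \sum_l z 0 l ^+ 2 =
    dist2 z u + (\sum_l resid z u l * pi l) *+ 2 + \sum_l pi l ^+ 2.
  rewrite -sumrMnl -!big_split /=; apply: eq_bigr => l _.
  by rewrite -sqrrD /resid -/(pi l) subrK.
have -> : \sum_l resid z u l * pi l = 0.
  under eq_bigr do rewrite mulr_sumr; rewrite exchange_big big1 //= => j _.
  under eq_bigr do rewrite mulrCA; by rewrite -mulr_sumr resid_orth mulr0.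
by rewrite mul0rn addr0 lerDl sumr_ge0 // => l _; rewrite sqr_ge0.
Qed.

Lemma dotrD z z' j : dotr (z + z') u j = dotr z u j + dotr z' u j.
Proof. by rewrite -big_split; apply: eq_bigr => l _; rewrite mxE mulrDl. Qed.

Lemma resid_add_span z (c : 'I_k -> R) l :
  resid (z + \sum_j c j *: row j u) u l = resid z u l.
Proof.
have e l' : (\sum_j c j *: row j u) 0 l' = \sum_j c j * u j l'.
  by rewrite summxE; apply: eq_bigr => j _; rewrite !mxE.
have d j : dotr (\sum_j c j *: row j u) u j = c j * nrm2 u j.
  by rewrite -sum_rows; apply: eq_bigr => l' _; rewrite e.
rewrite /resid mxE e.
rewrite [X in _ - X](_ : _ = \sum_j dotr z u j / nrm2 u j * u j l + \sum_j c j * u j l).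
  by rewrite opprD addrACA subrr addr0.
rewrite -big_split; apply: eq_bigr => j _ /=.
by rewrite dotrD d mulrDl mulfK ?nrm2_neq0 // mulrDl.
Qed.

Lemma rows_free : free [seq row j u | j <- enum 'I_k].
Proof.
have -> : [seq row j u | j <- enum 'I_k] = [tuple row j u | j < k] by [].
apply/freeP => c c0 j.
have := sum_rows c j; rewrite big1 => [/esym/eqP|l _].
  by rewrite mulf_eq0 (negPf (nrm2_neq0 j uo)) orbF => /eqP.
have := congr1 (fun v : 'rV_n => v 0 l) c0; rewrite summxE mxE => c0l.
rewrite [X in X * _](_ : _ = 0) ?mul0r // -[RHS]c0l; apply: eq_bigr => i _.
by rewrite -tnth_nth tnth_mktuple !mxE.
Qed.

Lemma mem_span_rows v : v \in <<[seq row j u | j <- enum 'I_k]>>%VS ->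
  exists c : 'I_k -> R, v = \sum_j c j *: row j u.
Proof.
have -> : [seq row j u | j <- enum 'I_k] = [tuple row j u | j < k] by [].
move/coord_span => ->; exists (fun j => coord [tuple row j u | j < k] j v).
by apply: eq_bigr => j _; rewrite -tnth_nth tnth_mktuple.
Qed.
End Orthogonal.
End Residual.

(** * Orthogonality and the sections as test functions *)

Section TestFunctions.
Variables (R : realType) (n k : nat) (eta : R) (Z : 'I_(n - k) -> seq 'rV[R]_n).

(* [inl (a, b)] with [a < b] tests the orthogonality of rows [a] and [b]; for
   [b <= a] it is a dummy index that is not in [tests]. *)
Definition test_index : eqType := (('I_k * 'I_k) + ('I_(n - k) * 'I_k))%type.

(** A dummy index gets [(a, a)] so that [test_char_le] holds for all indices; [test] is 0 there,
    which is compatible with every character. *)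
Definition test_char (c : test_index) : 'I_k * 'I_k :=
  match c with
  | inl (a, b) => if (a < b)%N then (a, b) else (a, a)
  | inr (_, j) => (j, j)
  end.

Definition test (c : test_index) (u : 'M[R]_(k, n)) : R :=
  match c with
  | inl (a, b) => if (a < b)%N then \sum_l u a l * u b l else 0
  | inr (i, j) => \sum_(z <- Z i) weight eta z u * dotr z u j
  end.

Definition tests : seq test_index :=
  [seq inl q | q <- enum [pred q : 'I_k * 'I_k | (q.1 < q.2)%N]] ++
  [seq inr q | q <- enum {: 'I_(n - k) * 'I_k}].

Lemma test_char_le c : ((test_char c).1 <= (test_char c).2)%N.
Proof. by case: c => [[a b]|[i j]] //=; case: ifP => //= /ltnW. Qed.

Lemma test_flip c j u : test c (flip R n j u) = (-1) ^+ chi test_char c j * test c u.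
Proof.
case: c => [[a b]|[i j']]; rewrite /test /chi /=.
  case: ltnP => ab; last by rewrite mulr0.
  rewrite mulr_sumr; apply: eq_bigr => l _; rewrite !flipE mulrACA -signr_addb.
  congr (_ * _); congr (_ ^+ _); rewrite [a == j]eq_sym [b == j]eq_sym /=.
  case: eqP => [->|_] //=; case: eqP => // e.
  by rewrite e ltnn in ab.
rewrite orbb mulr_sumr; apply: eq_bigr => z _.
by rewrite weight_flip dotr_flip mulrCA [j' == j]eq_sym.
Qed.

Lemma test_continuous c u : octa u -> {for u, continuous (test c)}.
Proof.
move=> uo; case: c => [[a b]|[i j]]; rewrite /test.
  by case: ltnP => _; [exact: row_dot_continuous|exact: cst_continuous].
by apply: cvg_sumr => z; exact: weight_dotr_continuous.
Qed.

Lemma sum_ltn (m j : nat) : (\sum_(b < m) (j < b) = m - j.+1)%N.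
Proof.
elim: m => [|m IH]; first by rewrite big_ord0.
by rewrite big_ord_recr /= IH; lia.
Qed.

(** Row [j] is the first row of [k - j - 1] orthogonality tests and carries [n - k] section tests;
    together these match the dimension of its sphere. *)
Lemma count_tests j : (k < n)%N ->
  count (fun c => (test_char c).1 == j) tests = (n.-1 - j)%N.
Proof.
move=> kn; rewrite count_cat !count_map -!sum1_count !big_enum_cond /=.
have -> : (\sum_(q : 'I_k * 'I_k | (q.1 < q.2)%N && ((test_char (inl q)).1 == j)) 1 = k - j.+1)%N.
  transitivity (\sum_(q : 'I_k * 'I_k) (if q.1 == j then (j < q.2)%N : nat else 0))%N.
    rewrite big_mkcond; apply: eq_bigr => -[a b] _ /=.
    case: ltnP => [ab|ab] /=; case: eqP => // e; first by rewrite -e ab.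
    by rewrite -e ltnNge ab.
  rewrite -(pair_bigA _ (fun a b : 'I_k => if a == j then (j < b)%N : nat else 0%N)) /=.
  rewrite (bigD1 j) //= eqxx sum_ltn big1 ?addn0 // => a /negPf ->.
  by rewrite big1.
have -> : (\sum_(q : 'I_(n - k) * 'I_k | (test_char (inr q)).1 == j) 1 = n - k)%N.
  transitivity (\sum_(q : 'I_(n - k) * 'I_k) (q.2 == j))%N.
    by rewrite big_mkcond; apply: eq_bigr => -[a b] _ /=; case: eqP.
  rewrite -(pair_bigA _ (fun a (b : 'I_k) => (b == j : nat))) /=.
  under eq_bigr do (rewrite (bigD1 j) //= eqxx big1 ?addn0 => [|b /negPf -> //]).
  by rewrite sum_nat_const card_ord muln1.
by have := ltn_ord j; lia.
Qed.

Lemma exists_test_frame : (k < n)%N ->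
  exists2 u : 'M[R]_(k, n), octa u /\ orthogonal_rows u &
    forall i j, \sum_(z <- Z i) weight eta z u * dotr z u j = 0.
Proof.
move=> kn.
have [u uo u0] := @common_zero R n k test_index test_char test test_char_le
  (fun c u => @test_continuous c u) (fun c j u _ => test_flip c j u) tests
  (leq_ltn_trans (leq0n _) kn) (fun j => count_tests j kn).
exists u; last first.
  move=> i j; apply: (u0 (inr (i, j))); rewrite mem_cat orbC.
  by apply/orP; left; apply: map_f; rewrite mem_enum.
split=> // a b ab.
wlog lt_ab : a b ab / (a < b)%N.
  move=> H; case: (ltngtP a b) => [|ba|/val_inj e]; first exact: H.
    by rewrite -[RHS](H b a) ?[b == a]eq_sym //; apply: eq_bigr => l _; rewrite mulrC.
  by rewrite e eqxx in ab.
have := u0 (inl (a, b)); rewrite /test /= lt_ab; apply.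
by rewrite mem_cat; apply/orP; left; apply: map_f; rewrite mem_enum.
Qed.
End TestFunctions.

(** The vanishing sums make 0 a nonnegative combination of the vectors [a x] in dimension [k]. By
    Caratheodory's theorem [k + 1] points of positive weight suffice, and the same combination of
    the points themselves differs from [p] only by residuals, which are small where the weight is
    positive. *)
Lemma near_convm (R : realType) (n k : nat) (X : set 'rV[R]_n) (p : 'rV[R]_n)
    (u : 'M[R]_(k, n)) (rho : R) (s : seq 'rV[R]_n) :
  octa u -> orthogonal_rows u -> 0 < rho -> (forall y, y \in s -> X y) ->
  (forall j, \sum_(y <- s) weight (rho ^+ 2) (y - p) u * dotr (y - p) u j = 0) ->
  (exists2 y, y \in s & 0 < weight (rho ^+ 2) (y - p) u) ->
  exists2 x, convm k.+1 X x & `|p - x| <= rho.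
Proof.
move=> uo u_orth rho0 sX sum0 [y0 y0s wy0].
pose I := 'I_(size s); pose y (x : I) := tnth (in_tuple s) x.
pose w (x : I) := weight (rho ^+ 2) (y x - p) u.
pose a (x : I) : 'rV[R]_k := \row_j dotr (y x - p) u j.
have w0 x : 0 <= w x by rewrite /w /weight le_max lexx.
have ys x : y x \in s by exact: mem_tnth.
have [||c [f [c0 wf c1 ca]]] := @caratheodory0 _ k I a w w0.
- have [x yx] : exists x, y x = y0.
    by have /tnthP[x ->] : y0 \in in_tuple s by []; exists x.
  rewrite (bigD1 x) //= ltr_wpDr //; first by rewrite sumr_ge0.
  by rewrite /w yx.
- apply/rowP => j; rewrite summxE mxE -[RHS](sum0 j) [RHS]big_tnth.
  by apply: eq_bigr => x _; rewrite !mxE.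
pose x := \sum_i c i *: y (f i); exists x.
  exists c, (fun i => y (f i)); split; first by move=> i; exact: sX.
  by split.
(* By [ca] the components along the rows of [u] cancel. *)
have xE l : (x - p) 0 l = \sum_i c i * resid (y (f i) - p) u l.
  have -> : x - p = \sum_i c i *: (y (f i) - p).
    under [RHS]eq_bigr do rewrite scalerBr.
    by rewrite sumrB -scaler_suml c1 scale1r.
  rewrite summxE; under [RHS]eq_bigr do rewrite mulrBr.
  rewrite sumrB; under eq_bigr do rewrite mxE.
  rewrite [X in _ - X](_ : _ = 0) ?subr0 //.
  under eq_bigr do rewrite mulr_sumr; rewrite exchange_big big1 //= => j _.
  rewrite (_ : \sum_i _ = (\sum_i c i * dotr (y (f i) - p) u j) * (u j l / nrm2 u j)).
    have := congr1 (fun v : 'rV_k => v 0 j) ca; rewrite summxE mxE.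
    by under eq_bigr do rewrite !mxE; move=> ->; rewrite mul0r.
  by rewrite mulr_suml; apply: eq_bigr => i _; rewrite -!mulrA [_^-1 * _]mulrC.
(* In the maximum norm, each coordinate of a residual is at most its Euclidean length, whose square
   [dist2] is below [rho ^+ 2]. *)
rewrite distrC /Num.norm /= mx_normrE; apply/bigmax_leP; split; first exact: ltW.
move=> [z l] _ /=; rewrite ord1 xE; apply: le_trans (ler_norm_sum _ _ _) _.
rewrite -[leRHS]mul1r -c1 mulr_suml; apply: ler_sum => i _.
rewrite normrM ger0_norm // ler_wpM2l //.
rewrite -(@ler_pXn2r _ 2) ?nnegrE ?normr_ge0 ?(ltW rho0) // real_normK ?num_real //.
have := wf i; rewrite /w /weight lt_max ltxx /= subr_gt0 => /ltW; apply: le_trans.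
by rewrite /dist2 (bigD1 l) //= lerDl sumr_ge0 // => l' _; rewrite sqr_ge0.
Qed.

Theorem theorem2p1 (R : realType) (n k : nat) (hkn : (k < n)%N)
  (X : 'I_(n - k) -> set 'rV[R]_n)
  (hX : forall i, compact (X i))
  (p : 'rV[R]_n)
  (hp : forall i, ~ convm (k.+1) (X i) p) :
  exists L : set 'rV[R]_n,
    affine_plane k L /\ L p /\ (forall i, L `&` X i = set0).
Proof.
(* The sets [convm k.+1 (X i)] are compact, hence closed, so a ball about [p] misses them all. *)
have : \forall x \near p, forall i, ~ convm k.+1 (X i) x.
  apply: (@filter_forall _ _ (fun i x => ~ convm k.+1 (X i) x) _ (nbhs_filter p)) => i.
  apply: (@open_nbhs_nbhs _ p (~` convm k.+1 (X i))); split; last exact: hp.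
  apply: closed_openC; apply: compact_closed; first exact: norm_hausdorff.
  exact: convm_compact.
move=> /nbhs_ballP[e /= e0 pe]; pose rho := e / 2.
have rho0 : 0 < rho by rewrite divr_gt0.
(* Maximum norm below [delta] gives squared Euclidean length at most [n * delta ^+ 2], which is
   below [rho ^+ 2]. *)
pose delta := rho / n.+1%:R; have delta0 : 0 < delta by rewrite divr_gt0.
have /choice [s hs] := fun i => compact_net (hX i) delta0.
have [u [uo u_orth] u0] :=
  @exists_test_frame R n k (rho ^+ 2) (fun i => [seq y - p | y <- s i]) hkn.
pose rows := [seq row j u | j <- enum 'I_k].
exists [set x | x - p \in <<rows>>%VS]; split; last split.
- exists p, <<rows>>%VS; split=> //.
  by have := rows_free uo u_orth; rewrite /free size_map size_enum_ord => /eqP.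
- by rewrite /= subrr mem0v.
move=> i; apply: contrapT => /eqP/set0P[x [/= xW Xx]].
have [sX net] := hs i; have [y ys yx] := net x Xx.
have [||x' cx' px'] := @near_convm _ _ _ (X i) p u rho (s i) uo u_orth rho0 sX.
- by move=> j; rewrite -[RHS](u0 i j) big_map.
- exists y => //; have [c xpE] := mem_span_rows xW.
  (* As [x - p] lies in the span of the rows, [y - p] and [y - x] have the same residual. *)
  have ypE : y - p = (y - x) + \sum_j c j *: row j u by rewrite -xpE addrA subrK.
  have -> : weight (rho ^+ 2) (y - p) u = weight (rho ^+ 2) (y - x) u.
    congr (Num.max _ (_ - _)); apply: eq_bigr => l _.
    by rewrite ypE (resid_add_span uo u_orth).
  rewrite /weight lt_max ltxx /= subr_gt0.
  apply: le_lt_trans (dist2_le uo u_orth (y - x)) _.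
  apply: (@le_lt_trans _ _ (\sum_(l < n) delta ^+ 2)).
    apply: ler_sum => l _; rewrite -[X in X <= _]real_normK ?num_real //.
    rewrite ler_pXn2r ?nnegrE ?normr_ge0 ?(ltW delta0) //; apply: le_trans (ltW yx).
    rewrite {2}/Num.norm /= mx_normrE.
    exact: (@le_bigmax _ _ _ 0 (fun q : 'I_1 * 'I_n => `|(y - x) q.1 q.2|) (0, l)).
  rewrite sumr_const card_ord -mulr_natl /delta expr_div_n mulrCA gtr_pMr ?exprn_gt0 //.
  rewrite ltr_pdivrMr ?exprn_gt0 // mul1r -natrX ltr_nat expnS expn1; lia.
apply: (pe x') cx'; rewrite -ball_normE /ball_ /=; apply: le_lt_trans px' _.
by rewrite /rho ltr_pdivrMr // ltr_pMr // ltr1n.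
Qed.
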